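(* Let $F$ be an integral binary quartic form of non-zero discriminant. Then $F\in V_{\mathcal{J}}(\mathbb{Z})$ if and only if $F = h(f,g)$ for some integral binary quadratic forms $h,f,g$ such that $\mathcal{J}_{(f,g)}(x,y)$ is proportional to $\mathcal{J}(x,y)$. In this case, $(\Delta(h)\Delta(\mathcal{J}_{(f,g)})/4)^2$ divides $\Delta(F)$, and the pair $(f,g)$ may be taken to be primitive. Moreover, if $F=h(f,g)$ and $F=h'(f',g')$ are two such representations of $F$ with $(f,g)$ and $(f',g')$ primitive, then $h$ and $h'$ are $\operatorname{GL}_2(\mathbb{Z})$-equivalent.
   Context: Fix an integral and primitive binary quadratic form $\mathcal{J}(x,y)=\alpha x^2+\beta xy+\gamma y^2$ with $\beta^2-4\alpha\gamma\neq 0$ and $\gcd(\alpha,\beta,\gamma)=1$. Let $M_{\mathcal{J}}=\begin{pmatrix}\beta & 2\gamma\\ -2\alpha & -\beta\end{pmatrix}$. For $T=\begin{pmatrix}t_1&t_2\\t_3&t_4\end{pmatrix}\in\operatorname{GL}_2(\mathbb{R})$, the twisted action on binary quartic forms is $F_T(x,y)=\det(T)^{-2}F(t_1x+t_2y,t_3x+t_4y)$ and on binary quadratic forms is $\varphi_T(x,y)=\det(T)^{-1}\varphi(t_1x+t_2y,t_3x+t_4y)$; $\operatorname{GL}_2(\mathbb{Z})$-equivalence of $h,h'$ means $h=h'_T$ for some $T\in\operatorname{GL}_2(\mathbb{Z})$. Define $V_{\mathcal{J}}(\mathbb{Z})$ as the set of integral binary quartic forms $F$ with $F_{M_{\mathcal{J}}}=F$.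 For a binary quadratic form $\varphi(x,y)=\varphi_2x^2+\varphi_1xy+\varphi_0y^2$, write $\Delta(\varphi)=\varphi_1^2-4\varphi_2\varphi_0$; $\Delta(F)$ denotes the discriminant of the quartic form $F$. For a pair $(f,g)$ of binary quadratic forms, the Jacobian determinant is $\mathcal{J}_{(f,g)}(x,y)=\tfrac12\bigl(\tfrac{\partial f}{\partial x}\tfrac{\partial g}{\partial y}-\tfrac{\partial f}{\partial y}\tfrac{\partial g}{\partial x}\bigr)=(f_2g_1-f_1g_2)x^2+2(f_2g_0-f_0g_2)xy+(f_1g_0-f_0g_1)y^2$, with coefficients denoted $\mathcal{J}_{(f,g),2},\mathcal{J}_{(f,g),1},\mathcal{J}_{(f,g),0}$. For integral $f,g$, the pair $(f,g)$ is called primitive if $\Delta(\mathcal{J}_{(f,g)})\neq 0$ and $\gcd(\mathcal{J}_{(f,g),2},\mathcal{J}_{(f,g),1}/2,\mathcal{J}_{(f,g),0})=1$. The notation $h(f,g)$ means substituting $f,g$ for the two variables of $h$.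
   Formalization: The final clause fails for the twisted action (J=xy, F=2x^4+x^2y^2+3y^4, pairs (x^2,±y^2)); instead h and h' are shown GL_2(Z)-equivalent by substitution without the factor det(T)^{-1}, and by the twisted action when J_(f,g)=J_(f',g'). *)

(* Defs.v *)
From mathcomp Require Import all_boot all_order all_algebra.
From mathcomp Require Import mpoly.
From mathcomp Require Import ring.

Set Implicit Arguments.
Unset Strict Implicit.
Unset Printing Implicit Defensive.

Import GRing.Theory Num.Theory.
Local Open Scope ring_scope.

(* Binary forms of degree d over R are the F : {mpoly R[2]} with
   F \is d.-homog; 'X_0 is x and 'X_1 is y. *)

Section BinaryForms.
Variable R : comUnitRingType.
Implicit Types (F f g q : {mpoly R[2]}) (T : 'M[R]_2).

(* coefficient of x^i y^j *)
Definition bcoef F (i j : nat) : R := F@_[multinom [tuple i; j]].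

(* F(f, g) *)
Definition bsubst F f g : {mpoly R[2]} := F \mPo [tuple f; g].

(* F(t1 x + t2 y, t3 x + t4 y) *)
Definition linsubst T F : {mpoly R[2]} :=
  bsubst F (T 0 0 *: 'X_0 + T 0 1 *: 'X_1) (T 1 0 *: 'X_0 + T 1 1 *: 'X_1).

(* Only meaningful when T is invertible. *)
Definition twist4 T F : {mpoly R[2]} := (\det T) ^- 2 *: linsubst T F.
Definition twist2 T q : {mpoly R[2]} := (\det T)^-1 *: linsubst T q.

Definition disc2 q : R := bcoef q 1 1 ^+ 2 - 4 * bcoef q 2 0 * bcoef q 0 2.

(* The discriminant of a x^4 + b x^3 y + c x^2 y^2 + d x y^3 + e y^4, with the
   usual normalisation: see disc4_prod_linear. *)
Definition quartic_disc (a b c d e : R) : R :=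
  256 * a ^+ 3 * e ^+ 3 - 192 * a ^+ 2 * b * d * e ^+ 2
  - 128 * a ^+ 2 * c ^+ 2 * e ^+ 2 + 144 * a ^+ 2 * c * d ^+ 2 * e
  - 27 * a ^+ 2 * d ^+ 4 + 144 * a * b ^+ 2 * c * e ^+ 2
  - 6 * a * b ^+ 2 * d ^+ 2 * e - 80 * a * b * c ^+ 2 * d * e
  + 18 * a * b * c * d ^+ 3 + 16 * a * c ^+ 4 * e
  - 4 * a * c ^+ 3 * d ^+ 2 - 27 * b ^+ 4 * e ^+ 2
  + 18 * b ^+ 3 * c * d * e - 4 * b ^+ 3 * d ^+ 3
  - 4 * b ^+ 2 * c ^+ 3 * e + b ^+ 2 * c ^+ 2 * d ^+ 2.

Definition disc4 F : R :=
  quartic_disc (bcoef F 4 0) (bcoef F 3 1) (bcoef F 2 2) (bcoef F 1 3)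
    (bcoef F 0 4).

(* Half of the Jacobian determinant of (f, g); the division by 2 is carried out
   on the coefficients, see jac_mderiv. *)
Definition jac f g : {mpoly R[2]} :=
  let f2 := bcoef f 2 0 in let f1 := bcoef f 1 1 in let f0 := bcoef f 0 2 in
  let g2 := bcoef g 2 0 in let g1 := bcoef g 1 1 in let g0 := bcoef g 0 2 in
  (f2 * g1 - f1 * g2) *: 'X_0 ^+ 2
  + (2 * (f2 * g0 - f0 * g2)) *: ('X_0 * 'X_1)
  + (f1 * g0 - f0 * g1) *: 'X_1 ^+ 2.

End BinaryForms.

Definition quad_form (J : {mpoly int[2]}) := J \is 2.-homog.
Definition quartic_form (F : {mpoly int[2]}) := F \is 4.-homog.

Definition primitive_form (J : {mpoly int[2]}) : Prop :=
  gcdz (gcdz (bcoef J 2 0) (bcoef J 1 1)) (bcoef J 0 2) = 1.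

Definition M_of (J : {mpoly int[2]}) : 'M[int]_2 :=
  let al := bcoef J 2 0 in let be := bcoef J 1 1 in let ga := bcoef J 0 2 in
  \matrix_(i, j) if i == 0 then (if j == 0 then be else 2 * ga)
                 else (if j == 0 then - 2 * al else - be).

Definition toQ (F : {mpoly int[2]}) : {mpoly rat[2]} := map_mpoly intr F.

(* M_of J is in general not invertible over int, so the twisted action is
   computed over rat. *)
Definition in_VJ (J F : {mpoly int[2]}) : Prop :=
  quartic_form F /\ twist4 (map_mx intr (M_of J)) (toQ F) = toQ F.

Definition proportional (p q : {mpoly int[2]}) : Prop :=
  exists2 c : rat, c != 0 & toQ p = c *: toQ q.

Definition representation (J F h f g : {mpoly int[2]}) : Prop :=
  [/\ quad_form h, quad_form f, quad_form g, F = bsubst h f g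
    & proportional (jac f g) J].

(* The middle coefficient of jac f g is even, so both divisions below are
   exact: see dvd2_jac11 and dvd4_disc2_jac. *)
Definition primitive_pair (f g : {mpoly int[2]}) : Prop :=
  disc2 (jac f g) != 0 /\
  gcdz (gcdz (bcoef (jac f g) 2 0) (bcoef (jac f g) 1 1 %/ 2)%Z)
       (bcoef (jac f g) 0 2) = 1.

Definition GL2Z_twist_equiv (h h' : {mpoly int[2]}) : Prop :=
  exists2 T : 'M[int]_2, T \in unitmx & h = twist2 T h'.

(* Equivalence under substitution, without the factor (\det T)^-1.  For \det T = -1
   the two notions differ by a sign, and a sign is what separates the h of two
   representations: with x^2, y^2 and x^2, -y^2,
     2 x^4 + x^2 y^2 + 3 y^4 = h(x^2, y^2) = h'(x^2, - y^2)
   for h = 2 x^2 + x y + 3 y^2 and h' = 2 x^2 - x y + 3 y^2, which satisfy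
   GL2Z_equiv h h' but not GL2Z_twist_equiv h h'. *)
Definition GL2Z_equiv (h h' : {mpoly int[2]}) : Prop :=
  exists2 T : 'M[int]_2, T \in unitmx & h = linsubst T h'.

Lemma jac_identity (A : comNzRingType) (x y f2 f1 f0 g2 g1 g0 : A) :
  ((f2 * g1 - f1 * g2) * x ^+ 2
    + (f2 * g0 - f0 * g2) *+ 2 * (x * y)
    + (f1 * g0 - f0 * g1) * y ^+ 2) *+ 2
  = ((f2 + f2) * x + f1 * y) * (g1 * x + (g0 + g0) * y)
    - (f1 * x + (f0 + f0) * y) * ((g2 + g2) * x + g1 * y).
Proof. by ring. Qed.

Lemma prod_linear_identity (A : comNzRingType)
    (x y a0 a1 a2 a3 b0 b1 b2 b3 : A) :
  (a0 * x + b0 * y) * ((a1 * x + b1 * y) * ((a2 * x + b2 * y)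
    * ((a3 * x + b3 * y) * 1)))
  = a0 * a1 * a2 * a3 * (x ^+ 4 * y ^+ 0)
  + (b0 * a1 * a2 * a3 + a0 * b1 * a2 * a3 + a0 * a1 * b2 * a3
     + a0 * a1 * a2 * b3) * (x ^+ 3 * y ^+ 1)
  + (b0 * b1 * a2 * a3 + b0 * a1 * b2 * a3 + b0 * a1 * a2 * b3
     + a0 * b1 * b2 * a3 + a0 * b1 * a2 * b3 + a0 * a1 * b2 * b3)
    * (x ^+ 2 * y ^+ 2)
  + (a0 * b1 * b2 * b3 + b0 * a1 * b2 * b3 + b0 * b1 * a2 * b3
     + b0 * b1 * b2 * a3) * (x ^+ 1 * y ^+ 3)
  + b0 * b1 * b2 * b3 * (x ^+ 0 * y ^+ 4).
Proof. by ring. Qed.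

Section Coefficients.
Variable R : comUnitRingType.
Implicit Types (F f g q : {mpoly R[2]}).

Lemma mcoeff_monXY (i j : nat) (m : 'X_{1..2}) :
  ('X_0 ^+ i * 'X_1 ^+ j : {mpoly R[2]})@_m = ((m 0%R == i) && (m 1%R == j))%:R.
Proof.
rewrite !mpolyXn -mpolyXD mcoeffX; congr (_%:R); congr nat_of_bool.
apply/eqP/andP => [<-|[/eqP e0 /eqP e1]].
  by rewrite !mnmDE !mulmnE !mnm1E /= ?mul1n ?mul0n ?addn0 ?add0n !eqxx.
apply/mnmP => k; rewrite mnmDE !mulmnE !mnm1E.
case: k => [[|[|k]] // hk].
  have -> : Ordinal hk = 0 by apply/val_inj.
  by rewrite e0 /= mul1n mul0n addn0.
have -> : Ordinal hk = 1 by apply/val_inj.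
by rewrite e1 /= mul1n mul0n add0n.
Qed.

Lemma bcoef_monXY (i j k l : nat) :
  bcoef ('X_0 ^+ i * 'X_1 ^+ j : {mpoly R[2]}) k l = ((k == i) && (l == j))%:R.
Proof. by rewrite /bcoef mcoeff_monXY !multinomE. Qed.

Lemma bcoefD F f i j : bcoef (F + f) i j = bcoef F i j + bcoef f i j.
Proof. exact: mcoeffD. Qed.

Lemma bcoefZ (c : R) F i j : bcoef (c *: F) i j = c * bcoef F i j.
Proof. exact: mcoeffZ. Qed.

Lemma homog_expand (d : nat) F : F \is d.-homog ->
  F = \sum_(i < d.+1) bcoef F (d - i) i *: ('X_0 ^+ (d - i) * 'X_1 ^+ i).
Proof.
move=> /dhomogP hF; apply/mpolyP => m.
rewrite raddf_sum /=.
under eq_bigr => i _ do rewrite mcoeffZ mcoeff_monXY.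
have dm : mdeg m = (m 0%R + m 1%R)%N 
    by rewrite mdegE big_ord_recl big_ord1; congr (_ + m _)%N; apply/val_inj.
have hm : m = [multinom [tuple m 0%R; m 1%R]].
  apply/mnmP => -[[|[|k]] // hk]; rewrite multinomE (tnth_nth 0%N) /=;
  by congr (m _); apply/val_inj.
case: (eqVneq (mdeg m) d) => [ed|nd].
  have le1 : (m 1%R < d.+1)%N by rewrite ltnS -ed dm leq_addl.
  rewrite (bigD1 (Ordinal le1)) //= big1 => [|i ni].
    have -> : (d - m 1%R)%N = m 0%R by rewrite -ed dm addnK.
    by rewrite !eqxx mulr1 addr0 {1}hm.
  rewrite (_ : (m 1%R == i) = false) ?andbF ?mulr0 //.
  by apply/negbTE; apply: contra ni => /eqP e; apply/eqP/val_inj.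
rewrite big1 => [|i _].
  apply: memN_msupp_eq0; apply/negP => /hF e.
  by rewrite -e eqxx in nd.
case: andP => [[/eqP e0 /eqP e1]|]; last by rewrite mulr0.
by case/eqP: nd; rewrite dm e0 e1 subnK // -ltnS.
Qed.

Lemma quad_expand q : q \is 2.-homog ->
  q = bcoef q 2 0 *: 'X_0 ^+ 2 + bcoef q 1 1 *: ('X_0 * 'X_1)
      + bcoef q 0 2 *: 'X_1 ^+ 2.
Proof.
move=> /homog_expand {1}->.
by rewrite !big_ord_recr big_ord0 /= !subnn !expr0 !expr1 mulr1 mul1r add0r.
Qed.

Lemma mderivXU (i j : 'I_2) : ('X_i : {mpoly R[2]})^`M(j) = (i == j)%:R.
Proof.
rewrite mderivX mnm1E; case: eqVneq => [->|_]; last by rewrite scale0r.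
rewrite (_ : (U_(j) - U_(j))%MM = 0%MM) ?mpolyX0 ?scale1r //.
by apply/mnmP => k; rewrite mnmBE subnn mnm0E.
Qed.

Lemma mderiv_quad (a b c : R) (q : {mpoly R[2]}) :
  q = a *: 'X_0 ^+ 2 + b *: ('X_0 * 'X_1) + c *: 'X_1 ^+ 2 ->
  q^`M(0) = (a + a) *: 'X_0 + b *: 'X_1 /\ q^`M(1) = b *: 'X_0 + (c + c) *: 'X_1.
Proof.
move=> ->; rewrite !mderivD !mderivZ !expr2 !mderivM !mderivXU !eqxx.
rewrite (_ : (0 == 1 :> 'I_2) = false) // (_ : (1 == 0 :> 'I_2) = false) //.
by rewrite !(mulr0, mul0r, mulr1, mul1r, addr0, add0r, scaler0) !scalerDr !scalerDl.
Qed.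

Lemma jac_mderiv f g : f \is 2.-homog -> g \is 2.-homog ->
  jac f g *+ 2 = f^`M(0) * g^`M(1) - f^`M(1) * g^`M(0).
Proof.
move=> /quad_expand /mderiv_quad [-> ->] /quad_expand /mderiv_quad [-> ->].
rewrite /jac; move: (bcoef f 2 0) (bcoef f 1 1) (bcoef f 0 2) => a b c.
move: (bcoef g 2 0) (bcoef g 1 1) (bcoef g 0 2) => a' b' c'.
rewrite mulr_natl -!mul_mpolyC.
rewrite mpolyCMn.
rewrite !mpolyCB.
rewrite !mpolyCM.
rewrite !(mpolyCD _ a a, mpolyCD _ c c, mpolyCD _ a' a', mpolyCD _ c' c').
exact: jac_identity.
Qed.

Lemma jac_coefs f g :
  [/\ bcoef (jac f g) 2 0 = bcoef f 2 0 * bcoef g 1 1 - bcoef f 1 1 * bcoef g 2 0,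
      bcoef (jac f g) 1 1 = 2 * (bcoef f 2 0 * bcoef g 0 2 - bcoef f 0 2 * bcoef g 2 0)
    & bcoef (jac f g) 0 2 = bcoef f 1 1 * bcoef g 0 2 - bcoef f 0 2 * bcoef g 1 1].
Proof.
have E a b c (i j : nat) :
    bcoef (a *: 'X_0 ^+ 2 + b *: ('X_0 * 'X_1) + c *: 'X_1 ^+ 2 : {mpoly R[2]}) i j
    = a * ((i == 2%N) && (j == 0%N))%:R + b * ((i == 1%N) && (j == 1%N))%:R
      + c * ((i == 0%N) && (j == 2%N))%:R.
  rewrite !bcoefD !bcoefZ -!bcoef_monXY !expr0 !expr1 mulr1 mul1r //.
rewrite /jac; move: (bcoef f 2 0) (bcoef f 1 1) (bcoef f 0 2) => f2 f1 f0.
move: (bcoef g 2 0) (bcoef g 1 1) (bcoef g 0 2) => g2 g1 g0.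
split; rewrite E.
- by rewrite mulr1 !mulr0 !addr0.
- by rewrite mulr1 !mulr0 addr0 add0r.
- by rewrite mulr1 !mulr0 !add0r.
Qed.

Lemma disc4_prod_linear (a b : 'I_4 -> R) :
  disc4 (\prod_i (a i *: 'X_0 + b i *: 'X_1))
  = \prod_(j < 4) \prod_(i < 4 | (i < j)%N) (a i * b j - a j * b i) ^+ 2.
Proof.
have E : \prod_i (a i *: 'X_0 + b i *: 'X_1) =
  (a 0 * a 1 * a 2 * a 3) *: ('X_0 ^+ 4 * 'X_1 ^+ 0)
  + (b 0 * a 1 * a 2 * a 3 + a 0 * b 1 * a 2 * a 3 + a 0 * a 1 * b 2 * a 3
     + a 0 * a 1 * a 2 * b 3) *: ('X_0 ^+ 3 * 'X_1 ^+ 1)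
  + (b 0 * b 1 * a 2 * a 3 + b 0 * a 1 * b 2 * a 3 + b 0 * a 1 * a 2 * b 3
     + a 0 * b 1 * b 2 * a 3 + a 0 * b 1 * a 2 * b 3 + a 0 * a 1 * b 2 * b 3)
    *: ('X_0 ^+ 2 * 'X_1 ^+ 2)
  + (a 0 * b 1 * b 2 * b 3 + b 0 * a 1 * b 2 * b 3 + b 0 * b 1 * a 2 * b 3
     + b 0 * b 1 * b 2 * a 3) *: ('X_0 ^+ 1 * 'X_1 ^+ 3)
  + (b 0 * b 1 * b 2 * b 3) *: ('X_0 ^+ 0 * 'X_1 ^+ 4) :> {mpoly R[2]}.
  rewrite !big_ord_recl big_ord0 /=.
  have -> : lift ord0 (ord0 : 'I_3) = 1 by apply/val_inj.
  have -> : lift ord0 (lift ord0 (ord0 : 'I_2)) = 2 by apply/val_inj.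
  have -> : lift ord0 (lift ord0 (lift ord0 (ord0 : 'I_1))) = 3 by apply/val_inj.
  rewrite -!mul_mpolyC !(mpolyCD, mpolyCM).
  exact: prod_linear_identity.
rewrite E /disc4 !bcoefD !bcoefZ !bcoef_monXY /= !(mulr1, mulr0, addr0, add0r).
under eq_bigr => j _ do rewrite big_mkcond.
rewrite !big_ord_recl !big_ord0 /=.
have -> : lift ord0 (ord0 : 'I_3) = 1 by apply/val_inj.
have -> : lift ord0 (lift ord0 (ord0 : 'I_2)) = 2 by apply/val_inj.
have -> : lift ord0 (lift ord0 (lift ord0 (ord0 : 'I_1))) = 3 by apply/val_inj.
rewrite /quartic_disc.
ring.
Qed.

End Coefficients.

Lemma dvd2_jac11 (f g : {mpoly int[2]}) : (2 %| bcoef (jac f g) 1 1)%Z.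
Proof. by case: (jac_coefs f g) => _ -> _; apply: dvdz_mulr. Qed.

Lemma dvd4_disc2_jac (f g : {mpoly int[2]}) : (4 %| disc2 (jac f g))%Z.
Proof.
case: (jac_coefs f g) => e2 e1 e0; rewrite /disc2 e2 e1 e0.
move: (bcoef f 2 0) (bcoef f 1 1) (bcoef f 0 2) => f2 f1 f0.
move: (bcoef g 2 0) (bcoef g 1 1) (bcoef g 0 2) => g2 g1 g0.
apply/dvdzP; exists ((f2 * g0 - f0 * g2) ^+ 2
  - (f2 * g1 - f1 * g2) * (f1 * g0 - f0 * g1)).
ring.
Qed.

(* Main.v *)
(* Let W be the lattice of integral quadratic forms q orthogonal to J, that is
   2 al q0 - be q1 + 2 ga q2 = 0.  Substituting M_of J multiplies q in W by
   disc2 J, and the pairs (f, g) with jac f g proportional to J are the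
   independent pairs in W; primitive pairs are the bases of W.  So h(f, g) is
   fixed, and conversely Cramer's rule writes a fixed quartic F as a rational
   combination of f^2, fg, g^2.  The 5 x 3 matrix of these three quartics has
   the minors m^3, k^3 + kmn and n^3, where jac f g = m x^2 + 2k xy + n y^2;
   they are coprime when m, k, n are, so for a primitive pair h is integral and
   determined by F.  Two primitive pairs differ by a change of basis of W, which
   relates the corresponding h. *)
Require Import Defs.
From mathcomp Require Import all_boot all_order all_algebra.
From mathcomp Require Import mpoly ring.

Set Implicit Arguments.
Unset Strict Implicit.
Unset Printing Implicit Defensive.

Import GRing.Theory Num.Theory.
Local Open Scope ring_scope.

(** * Forms of degree 2 and 4 in coefficients, substitution, and Cramer's rule *)

Section FormSubstitution.
Variable R : comUnitRingType.
Implicit Types (F G f g h p q : {mpoly R[2]}) (T : 'M[R]_2) (u v w : nat -> R).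

Definition quad (a b c : R) : {mpoly R[2]} :=
  a *: 'X_0 ^+ 2 + b *: ('X_0 * 'X_1) + c *: 'X_1 ^+ 2.

Lemma bcoef_quad (a b c : R) (i j : nat) :
  bcoef (quad a b c) i j
  = a * ((i == 2%N) && (j == 0%N))%:R + b * ((i == 1%N) && (j == 1%N))%:R
    + c * ((i == 0%N) && (j == 2%N))%:R.
Proof. by rewrite !bcoefD !bcoefZ -!bcoef_monXY !expr0 !expr1 mulr1 mul1r. Qed.

Lemma quad_coefs (a b c : R) :
  [/\ bcoef (quad a b c) 2 0 = a, bcoef (quad a b c) 1 1 = b
    & bcoef (quad a b c) 0 2 = c].
Proof. by split; rewrite bcoef_quad /= !(mulr1, mulr0, addr0, add0r). Qed.

Lemma dhomogXU (i : 'I_2) : ('X_i : {mpoly R[2]}) \is 1.-homog.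
Proof. by rewrite dhomogX; apply/eqP; apply: mdeg1. Qed.

Lemma quad_homog (a b c : R) : quad a b c \is 2.-homog.
Proof.
rewrite /quad !expr2 !dhomogD ?dhomogZ //;
  exact: (dhomogM (dhomogXU _) (dhomogXU _)).
Qed.

Lemma quadE q : q \is 2.-homog ->
  q = quad (bcoef q 2 0) (bcoef q 1 1) (bcoef q 0 2).
Proof. exact: quad_expand. Qed.

Lemma bsubst_quad (a b c : R) f g :
  bsubst (quad a b c) f g = a *: (f * f) + b *: (f * g) + c *: (g * g).
Proof.
rewrite /bsubst !raddfD /= !linearZ /= !expr2 !rmorphM /= !comp_mpolyXU.
by rewrite -!tnth_nth.
Qed.

Lemma bsubst_homog h f g : h \is 2.-homog -> f \is 2.-homog -> g \is 2.-homog ->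
  bsubst h f g \is 4.-homog.
Proof.
move=> /quadE -> hf hg; rewrite bsubst_quad.
by rewrite !dhomogD ?dhomogZ //; apply: (@dhomogM _ _ _ 2 _ 2).
Qed.

Lemma bsubstM p q f g : bsubst (p * q) f g = bsubst p f g * bsubst q f g.
Proof. exact: rmorphM. Qed.

Lemma bsubstD p q f g : bsubst (p + q) f g = bsubst p f g + bsubst q f g.
Proof. exact: raddfD. Qed.

Lemma bsubstZ c p f g : bsubst (c *: p) f g = c *: bsubst p f g.
Proof. exact: comp_mpolyZ. Qed.

Lemma bsubstXn p n f g : bsubst (p ^+ n) f g = bsubst p f g ^+ n.
Proof. exact: rmorphXn. Qed.

Lemma bsubstX0 f g : bsubst 'X_0 f g = f.
Proof. by rewrite /bsubst comp_mpolyXU. Qed.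

Lemma bsubstX1 f g : bsubst 'X_1 f g = g.
Proof. by rewrite /bsubst comp_mpolyXU. Qed.

Lemma bsubst_bsubst h p q f g : h \is 2.-homog ->
  bsubst (bsubst h p q) f g = bsubst h (bsubst p f g) (bsubst q f g).
Proof. by move=> /quadE ->; rewrite !bsubst_quad !bsubstD !bsubstZ !bsubstM. Qed.

Lemma bsubst_linear (s t : R) f g :
  bsubst (s *: 'X_0 + t *: 'X_1) f g = s *: f + t *: g.
Proof. by rewrite bsubstD !bsubstZ bsubstX0 bsubstX1. Qed.

Lemma bsubst_linsubst T h f g : h \is 2.-homog ->
  bsubst (linsubst T h) f g =
  bsubst h (T 0 0 *: f + T 0 1 *: g) (T 1 0 *: f + T 1 1 *: g).
Proof. by move=> hh; rewrite bsubst_bsubst // 2!bsubst_linear. Qed.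

(* The coefficients of a quartic, by increasing power of y. *)
Definition qco F (i : nat) : R := bcoef F (4 - i) i.

Lemma qcoD F G i : qco (F + G) i = qco F i + qco G i.
Proof. exact: bcoefD. Qed.

Lemma qcoZ c F i : qco (c *: F) i = c * qco F i.
Proof. exact: bcoefZ. Qed.

Definition quartic (a b c d e : R) : {mpoly R[2]} :=
  a *: 'X_0 ^+ 4 + b *: ('X_0 ^+ 3 * 'X_1) + c *: ('X_0 ^+ 2 * 'X_1 ^+ 2)
  + d *: ('X_0 * 'X_1 ^+ 3) + e *: 'X_1 ^+ 4.

Lemma quartic0 : quartic 0 0 0 0 0 = 0.
Proof. by rewrite /quartic !scale0r !addr0. Qed.

Lemma quarticE F : F \is 4.-homog ->
  F = quartic (qco F 0) (qco F 1) (qco F 2) (qco F 3) (qco F 4).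
Proof.
move=> /homog_expand {1}->.
by rewrite !big_ord_recr big_ord0 /= !subnn !expr0 !expr1 mulr1 mul1r add0r.
Qed.

Lemma qco_quartic (a b c d e : R) :
  (qco (quartic a b c d e) 0 = a) * (qco (quartic a b c d e) 1 = b)
  * (qco (quartic a b c d e) 2 = c) * (qco (quartic a b c d e) 3 = d)
  * (qco (quartic a b c d e) 4 = e).
Proof.
(* The exponents 0 and 1 are written out so that every monomial has the shape that [bcoef_monXY]
   expects. *)
have E i : qco (a *: ('X_0 ^+ 4 * 'X_1 ^+ 0) + b *: ('X_0 ^+ 3 * 'X_1 ^+ 1)
      + c *: ('X_0 ^+ 2 * 'X_1 ^+ 2) + d *: ('X_0 ^+ 1 * 'X_1 ^+ 3)
      + e *: ('X_0 ^+ 0 * 'X_1 ^+ 4)) i =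
   a * ((4 - i == 4) && (i == 0))%N%:R + b * ((4 - i == 3) && (i == 1))%N%:R
   + c * ((4 - i == 2) && (i == 2))%N%:R + d * ((4 - i == 1) && (i == 3))%N%:R
   + e * ((4 - i == 0) && (i == 4))%N%:R.
  by rewrite !qcoD !qcoZ /qco !bcoef_monXY.
have {}E i := E i; rewrite !expr0 !expr1 !mulr1 !mul1r in E.
by do !split; rewrite E /= !(mulr1, mulr0, addr0, add0r).
Qed.

Lemma qco_mul f g : f \is 2.-homog -> g \is 2.-homog ->
  let f2 := bcoef f 2 0 in let f1 := bcoef f 1 1 in let f0 := bcoef f 0 2 in
  let g2 := bcoef g 2 0 in let g1 := bcoef g 1 1 in let g0 := bcoef g 0 2 in
  [/\ qco (f * g) 0 = f2 * g2, qco (f * g) 1 = f2 * g1 + f1 * g2,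
      qco (f * g) 2 = f2 * g0 + f1 * g1 + f0 * g2,
      qco (f * g) 3 = f1 * g0 + f0 * g1 & qco (f * g) 4 = f0 * g0].
Proof.
move=> /quadE ef /quadE eg f2 f1 f0 g2 g1 g0.
suff -> : f * g =
  quartic (f2 * g2) (f2 * g1 + f1 * g2) (f2 * g0 + f1 * g1 + f0 * g2)
    (f1 * g0 + f0 * g1) (f0 * g0) by split; rewrite qco_quartic.
rewrite ef eg -/f2 -/f1 -/f0 -/g2 -/g1 -/g0.
move: f2 f1 f0 g2 g1 g0 => {ef eg} f2 f1 f0 g2 g1 g0.
rewrite /quad /quartic -!mul_mpolyC !(mpolyCD, mpolyCM).
by ring.
Qed.

Lemma bsubst_quartic (a b c d e : R) f g :
  bsubst (quartic a b c d e) f g =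
  a *: f ^+ 4 + b *: (f ^+ 3 * g) + c *: (f ^+ 2 * g ^+ 2) + d *: (f * g ^+ 3)
  + e *: g ^+ 4.
Proof.
rewrite /quartic 4!bsubstD.
by congr (_ + _ + _ + _ + _); rewrite bsubstZ; congr (_ *: _);
   rewrite ?bsubstXn ?bsubstM ?bsubstXn ?bsubstX0 ?bsubstX1.
Qed.

Lemma linsubst_quartic T (a b c d e : R) :
  let t1 := T 0 0 in let t2 := T 0 1 in let t3 := T 1 0 in let t4 := T 1 1 in
  linsubst T (quartic a b c d e) = quartic
    (a * t1 ^+ 4 + b * t1 ^+ 3 * t3 + c * t1 ^+ 2 * t3 ^+ 2
     + d * t1 * t3 ^+ 3 + e * t3 ^+ 4)
    (4 * a * t1 ^+ 3 * t2 + b * (3 * t1 ^+ 2 * t2 * t3 + t1 ^+ 3 * t4)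
     + 2 * c * (t1 * t2 * t3 ^+ 2 + t1 ^+ 2 * t3 * t4)
     + d * (t2 * t3 ^+ 3 + 3 * t1 * t3 ^+ 2 * t4) + 4 * e * t3 ^+ 3 * t4)
    (6 * a * t1 ^+ 2 * t2 ^+ 2
     + 3 * b * (t1 * t2 ^+ 2 * t3 + t1 ^+ 2 * t2 * t4)
     + c * (t1 ^+ 2 * t4 ^+ 2 + 4 * t1 * t2 * t3 * t4 + t2 ^+ 2 * t3 ^+ 2)
     + 3 * d * (t1 * t3 * t4 ^+ 2 + t2 * t3 ^+ 2 * t4)
     + 6 * e * t3 ^+ 2 * t4 ^+ 2)
    (4 * a * t2 ^+ 3 * t1 + b * (3 * t2 ^+ 2 * t1 * t4 + t2 ^+ 3 * t3)
     + 2 * c * (t2 * t1 * t4 ^+ 2 + t2 ^+ 2 * t4 * t3)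
     + d * (t1 * t4 ^+ 3 + 3 * t2 * t4 ^+ 2 * t3) + 4 * e * t4 ^+ 3 * t3)
    (a * t2 ^+ 4 + b * t2 ^+ 3 * t4 + c * t2 ^+ 2 * t4 ^+ 2
     + d * t2 * t4 ^+ 3 + e * t4 ^+ 4).
Proof.
move=> t1 t2 t3 t4.
rewrite /linsubst -/t1 -/t2 -/t3 -/t4; move: t1 t2 t3 t4 => t1 t2 t3 t4.
rewrite bsubst_quartic /quartic -!mul_mpolyC.
rewrite !(mpolyCD, mpolyCM, rmorph_nat, rmorphXn) /=.
by ring.
Qed.

(* Cramer's rule for three of the five coefficients of h(f, g). *)
Definition det3 u v w (i j k : nat) : R :=
  u i * (v j * w k - v k * w j) - v i * (u j * w k - u k * w j)
  + w i * (u j * v k - u k * v j).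

Definition minor f g := det3 (qco (f * f)) (qco (f * g)) (qco (g * g)).

Definition cramer F f g (i j k : nat) : {mpoly R[2]} :=
  quad (det3 (qco F) (qco (f * g)) (qco (g * g)) i j k)
       (det3 (qco (f * f)) (qco F) (qco (g * g)) i j k)
       (det3 (qco (f * f)) (qco (f * g)) (qco F) i j k).

(** The column of h(f, g) is a combination of the three columns of the determinant, so putting it in
    place of one of them leaves only that one's coefficient. No division occurs, so the identity
    also holds for a vanishing minor. *)
Lemma cramer_bsubst h f g i j k : h \is 2.-homog ->
  cramer (bsubst h f g) f g i j k = minor f g i j k *: h.
Proof.
move=> /quadE ->; rewrite bsubst_quad /cramer /minor /det3 !qcoD !qcoZ.
move: (qco (f * f)) (qco (f * g)) (qco (g * g)) => u v w.
move: (u i) (u j) (u k) (v i) (v j) (v k) (w i) (w j) (w k).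
move: (bcoef h 2 0) (bcoef h 1 1) (bcoef h 0 2) => *.
by rewrite /quad !scalerDr !scalerA; congr (_ *: _ + _ *: _ + _ *: _); ring.
Qed.

(** Cramer's solution solves only the three chosen equations; the other two coefficients of F are
    controlled later, by invariance under [M_of J]. *)
Lemma qco_cramer F f g i j k l : l \in [:: i; j; k] ->
  qco (bsubst (cramer F f g i j k) f g) l = minor f g i j k * qco F l.
Proof.
rewrite bsubst_quad !qcoD !qcoZ /minor /det3.
move: (qco (f * f)) (qco (f * g)) (qco (g * g)) (qco F) => u v w y.
by rewrite !inE => /or3P[] /eqP ->;
   move: (u i) (u j) (u k) (v i) (v j) (v k) (w i) (w j) (w k) (y i) (y j) (y k);
   move=> *; ring.
Qed.

(* jac f g = pl2 x^2 + 2 pl1 x y + pl0 y^2; primitivity of (f, g) is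
   coprimality of the three. *)
Definition pl2 f g : R :=
  bcoef f 2 0 * bcoef g 1 1 - bcoef f 1 1 * bcoef g 2 0.
Definition pl1 f g : R :=
  bcoef f 2 0 * bcoef g 0 2 - bcoef f 0 2 * bcoef g 2 0.
Definition pl0 f g : R :=
  bcoef f 1 1 * bcoef g 0 2 - bcoef f 0 2 * bcoef g 1 1.

Lemma linsubst_quad T (a b c : R) :
  let t1 := T 0 0 in let t2 := T 0 1 in let t3 := T 1 0 in let t4 := T 1 1 in
  linsubst T (quad a b c) = quad (a * t1 ^+ 2 + b * t1 * t3 + c * t3 ^+ 2)
    (2 * a * t1 * t2 + b * (t1 * t4 + t2 * t3) + 2 * c * t3 * t4)
    (a * t2 ^+ 2 + b * t2 * t4 + c * t4 ^+ 2).
Proof.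
move=> t1 t2 t3 t4.
rewrite /linsubst -/t1 -/t2 -/t3 -/t4; move: t1 t2 t3 t4 => t1 t2 t3 t4.
rewrite bsubst_quad /quad -!mul_mpolyC.
rewrite !(mpolyCD, mpolyCM, rmorph_nat, rmorphXn) /=.
by ring.
Qed.

Lemma linsubst_homog2 T q : q \is 2.-homog -> linsubst T q \is 2.-homog.
Proof. by move=> /quadE ->; rewrite linsubst_quad quad_homog. Qed.

(** If h splits into linear factors, h(f, g) is a product of two members q1, q2 of the pencil of f
    and g, with discriminant disc(q1) disc(q2) Res(q1, q2)^2. Here Res(q1, q2) is disc(h) Res(f, g),
    and Res(f, g) is [pl1 f g ^+ 2 - pl2 f g * pl0 f g]. The product disc(q1) disc(q2) is symmetric
    in the two factors, hence a polynomial in the coefficients of h. *)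
Lemma disc4_bsubst h f g : h \is 2.-homog -> f \is 2.-homog -> g \is 2.-homog ->
  exists c : R, disc4 (bsubst h f g)
    = (disc2 h * (pl1 f g ^+ 2 - pl2 f g * pl0 f g)) ^+ 2 * c.
Proof.
move=> /quadE hh hf hg.
pose p := disc2 f; pose r := disc2 g.
pose q := 2 * bcoef f 1 1 * bcoef g 1 1 - 4 * bcoef f 2 0 * bcoef g 0 2
  - 4 * bcoef f 0 2 * bcoef g 2 0.
pose A := bcoef h 2 0; pose B := bcoef h 1 1; pose C := bcoef h 0 2.
(* [s ^+ 2 * p + s * t * q + t ^+ 2 * r] is the discriminant of [s *: f + t *: g];
   the cofactor is its resultant with h. *)
exists (p ^+ 2 * A ^+ 2 + p * q * A * B + p * r * (B ^+ 2 - 2 * A * C)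
  + q ^+ 2 * A * C + q * r * B * C + r ^+ 2 * C ^+ 2).
have -> : disc2 h = B ^+ 2 - 4 * A * C by [].
have E i : qco (bsubst h f g) i
    = A * qco (f * f) i + B * qco (f * g) i + C * qco (g * g) i.
  by rewrite hh bsubst_quad !qcoD !qcoZ.
rewrite /disc4 -[bcoef _ 4 0]/(qco _ 0) -[bcoef _ 3 1]/(qco _ 1).
rewrite -[bcoef _ 2 2]/(qco _ 2) -[bcoef _ 1 3]/(qco _ 3).
rewrite -[bcoef _ 0 4]/(qco _ 4) !E.
have [-> -> -> -> ->] := qco_mul hf hf.
have [-> -> -> -> ->] := qco_mul hf hg.
have [-> -> -> -> ->] := qco_mul hg hg.
rewrite /p /q /r /pl2 /pl1 /pl0 /disc2 /quartic_disc {E p q r hh}.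
move: A B C (bcoef f 2 0) (bcoef f 1 1) (bcoef f 0 2) => A B C a b c.
move: (bcoef g 2 0) (bcoef g 1 1) (bcoef g 0 2) => d e k.
by ring.
Qed.

Lemma quad_eq p q : p \is 2.-homog -> q \is 2.-homog ->
  bcoef p 2 0 = bcoef q 2 0 -> bcoef p 1 1 = bcoef q 1 1 ->
  bcoef p 0 2 = bcoef q 0 2 -> p = q.
Proof. by move=> /quadE hp /quadE hq e2 e1 e0; rewrite hp hq e2 e1 e0. Qed.

Lemma bsubst_scale (c : R) h f g : h \is 2.-homog ->
  bsubst h (c *: f) (c *: g) = c ^+ 2 *: bsubst h f g.
Proof.
move=> /quadE ->; rewrite !bsubst_quad !scalerDr.
by rewrite -!scalerAl -!scalerAr !scalerA; congr (_ *: _ + _ *: _ + _ *: _); ring.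
Qed.

Lemma cramerZ c F f g i j k : cramer (c *: F) f g i j k = c *: cramer F f g i j k.
Proof.
rewrite /cramer /quad !scalerDr !scalerA.
rewrite /det3 !qcoZ.
move: (qco (f * f)) (qco (f * g)) (qco (g * g)) (qco F) => u v w y.
move: (u i) (u j) (u k) (v i) (v j) (v k) (w i) (w j) (w k) (y i) (y j) (y k).
by move=> *; congr (_ *: _ + _ *: _ + _ *: _); ring.
Qed.

Lemma minor_pl f g : f \is 2.-homog -> g \is 2.-homog ->
  [/\ minor f g 0 1 2 = pl2 f g ^+ 3,
      minor f g 0 2 4 = pl1 f g ^+ 3 + pl1 f g * pl2 f g * pl0 f g
    & minor f g 2 3 4 = pl0 f g ^+ 3].
Proof.
move=> hf hg; rewrite /minor /det3 /pl2 /pl1 /pl0.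
have [-> -> -> -> ->] := qco_mul hf hf.
have [-> -> -> -> ->] := qco_mul hf hg.
have [-> -> -> -> ->] := qco_mul hg hg.
move: (bcoef f 2 0) (bcoef f 1 1) (bcoef f 0 2) => *.
by move: (bcoef g 2 0) (bcoef g 1 1) (bcoef g 0 2) => *; split; ring.
Qed.

(** The last hypothesis says that the 3 x 3 determinant of the coefficients of f, g, q vanishes.
    Cramer's rule then gives pl q = pl(q, g) f + pl(f, q) g for each of the three minors pl of (f,
    g), and the Bezout relation combines these into an expression without denominators. *)
Lemma span_of_orth f g q (x y z : R) :
  f \is 2.-homog -> g \is 2.-homog -> q \is 2.-homog ->
  x * pl2 f g + y * pl1 f g + z * pl0 f g = 1 ->
  pl2 f g * bcoef q 0 2 - pl1 f g * bcoef q 1 1 + pl0 f g * bcoef q 2 0 = 0 ->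
  q = (x * pl2 q g + y * pl1 q g + z * pl0 q g) *: f
      + (x * pl2 f q + y * pl1 f q + z * pl0 f q) *: g.
Proof.
move=> hf hg hq e1 e0.
have E (c d a : R) : c - d = a * 0 -> c = d.
  by rewrite mulr0 => /eqP; rewrite subr_eq0 => /eqP.
apply: quad_eq => //; first by rewrite dhomogD ?dhomogZ.
(* In each coordinate, two of the three Cramer identities hold identically. The third, for the minor
   that omits this coordinate, fails by the determinant up to sign; hence the factors [z], [- y] and
   [x]. *)
- apply: (@E _ _ z); rewrite -e0 -[bcoef q 2 0 in LHS]mulr1 -{1}e1.
  rewrite bcoefD !bcoefZ /pl2 /pl1 /pl0; clear.
  move: (bcoef f 2 0) (bcoef f 1 1) (bcoef f 0 2) => *.
  by move: (bcoef g 2 0) (bcoef g 1 1) (bcoef g 0 2) => *; ring.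
- apply: (@E _ _ (- y)); rewrite -e0 -[bcoef q 1 1 in LHS]mulr1 -{1}e1.
  rewrite bcoefD !bcoefZ /pl2 /pl1 /pl0; clear.
  move: (bcoef f 2 0) (bcoef f 1 1) (bcoef f 0 2) => *.
  by move: (bcoef g 2 0) (bcoef g 1 1) (bcoef g 0 2) => *; ring.
apply: (@E _ _ x); rewrite -e0 -[bcoef q 0 2 in LHS]mulr1 -{1}e1.
rewrite bcoefD !bcoefZ /pl2 /pl1 /pl0; clear.
move: (bcoef f 2 0) (bcoef f 1 1) (bcoef f 0 2) => *.
by move: (bcoef g 2 0) (bcoef g 1 1) (bcoef g 0 2) => *; ring.
Qed.

Lemma pl_span f g (a b c d : R) :
  let p := a *: f + b *: g in let q := c *: f + d *: g in
  [/\ pl2 p q = (a * d - b * c) * pl2 f g, pl1 p q = (a * d - b * c) * pl1 f g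
    & pl0 p q = (a * d - b * c) * pl0 f g].
Proof.
rewrite /pl2 /pl1 /pl0 !bcoefD !bcoefZ.
move: (bcoef f 2 0) (bcoef f 1 1) (bcoef f 0 2) => *.
by move: (bcoef g 2 0) (bcoef g 1 1) (bcoef g 0 2) => *; split; ring.
Qed.

End FormSubstitution.

(** * Eigenquartics of a linear substitution with three consecutive zero coefficients *)

Section EigenQuartics.
Variable R : idomainType.
Implicit Types (G : {mpoly R[2]}).

(* G vanishes to order 3 on the line y = 0, hence also on its preimage by T,
   which is another line. *)
Lemma eigenquartic_eq0_y (T : 'M[R]_2) (c : R) (d e : R)
  (G := quartic 0 0 0 d e) :
  T 0 0 * T 1 1 - T 0 1 * T 1 0 != 0 -> T 1 0 != 0 ->
  linsubst T G = c *: G -> d = 0 /\ e = 0.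
Proof.
move=> detT t3 /(congr1 (@qco _)); rewrite linsubst_quartic => E.
have := congr1 (@^~ 0%N) E; have := congr1 (@^~ 1%N) E => {E} /=.
rewrite !qcoZ !qco_quartic !(mulr0, mul0r, add0r).
move: (T 0 0) (T 0 1) (T 1 0) (T 1 1) detT t3 => t1 t2 t3 t4 detT nz E1 E0.
(* G is y^3 (d x + e y), so its image is (t3 x + t4 y)^3 times the image of d x + e y. The
   coefficients of x^4 and x^3 y vanish, which kills both coefficients of the image of the linear
   factor. *)
have H0 : d * t1 + e * t3 = 0.
  apply: (mulfI (expf_neq0 3 nz)); rewrite mulr0 -[RHS]E0; ring.
have H1 : d * t2 + e * t4 = 0.
  apply: (mulfI (expf_neq0 3 nz)); rewrite mulr0 -[RHS]E1.
  transitivity (t3 ^+ 3 * (d * t2 + e * t4) + 3 * t3 ^+ 2 * t4 * (d * t1 + e * t3)).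
    by rewrite H0 mulr0 addr0.
  ring.
split; apply: (mulfI detT); rewrite mulr0.
  transitivity (t4 * (d * t1 + e * t3) - t3 * (d * t2 + e * t4)); first by ring.
  by rewrite H0 H1 !mulr0 subr0.
transitivity (t1 * (d * t2 + e * t4) - t2 * (d * t1 + e * t3)); first by ring.
by rewrite H0 H1 !mulr0 subr0.
Qed.

(** The mirror image under exchange of x and y: G has a triple zero along x = 0 and along a second
    line, too much for a nonzero form of degree 4. *)
Lemma eigenquartic_eq0_x (T : 'M[R]_2) (c : R) (a b : R)
  (G := quartic a b 0 0 0) :
  T 0 0 * T 1 1 - T 0 1 * T 1 0 != 0 -> T 0 1 != 0 ->
  linsubst T G = c *: G -> a = 0 /\ b = 0.
Proof.
move=> detT t2 /(congr1 (@qco _)); rewrite linsubst_quartic => E.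
have := congr1 (@^~ 4%N) E; have := congr1 (@^~ 3%N) E => {E} /=.
rewrite !qcoZ !qco_quartic !(mulr0, mul0r, addr0).
move: (T 0 0) (T 0 1) (T 1 0) (T 1 1) detT t2 => t1 t2 t3 t4 detT nz E3 E4.
have H0 : a * t2 + b * t4 = 0.
  apply: (mulfI (expf_neq0 3 nz)); rewrite mulr0 -[RHS]E4; ring.
have H1 : a * t1 + b * t3 = 0.
  apply: (mulfI (expf_neq0 3 nz)); rewrite mulr0 -[RHS]E3.
  transitivity (t2 ^+ 3 * (a * t1 + b * t3) + 3 * t2 ^+ 2 * t1 * (a * t2 + b * t4)).
    by rewrite H0 mulr0 addr0.
  ring.
split; apply: (mulfI detT); rewrite mulr0.
  transitivity (t4 * (a * t1 + b * t3) - t3 * (a * t2 + b * t4)); first by ring.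
  by rewrite H0 H1 !mulr0 subr0.
transitivity (t1 * (a * t2 + b * t4) - t2 * (a * t1 + b * t3)); first by ring.
by rewrite H0 H1 !mulr0 subr0.
Qed.

End EigenQuartics.

(** * Determinants of order 2 and Bezout relations between three integers *)

Lemma det_mx2 (R : comNzRingType) (T : 'M[R]_2) :
  \det T = T 0 0 * T 1 1 - T 0 1 * T 1 0.
Proof.
rewrite (expand_det_row _ 0) !big_ord_recl big_ord0 /cofactor !det_mx11 !mxE /=.
have e1 : lift 0 0 = 1 :> 'I_2 by apply/val_inj.
have e0 : lift 1 0 = 0 :> 'I_2 by apply/val_inj.
by rewrite !e1 e0 expr0 expr1 mul1r addr0 mulN1r mulrN.
Qed.

Lemma bezout3P (a b c : int) :
  gcdz (gcdz a b) c = 1 <-> exists x y z, x * a + y * b + z * c = 1.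
Proof.
split=> [e|[x [y [z e]]]].
  have [u [v]] := Bezoutz (gcdz a b) c; rewrite e.
  have [x [y <-]] := Bezoutz a b => <-.
  by exists (u * x), (u * y), v; ring.
set d := gcdz _ _; have : (d %| x * a + y * b + z * c)%Z.
  rewrite !rpredD ?dvdz_mull ?dvdz_gcdr //.
    exact: dvdz_trans (dvdz_gcdl _ _) (dvdz_gcdl _ _).
  exact: dvdz_trans (dvdz_gcdl _ _) (dvdz_gcdr _ _).
by rewrite e dvdz1 => /eqP; rewrite /d /gcdz => /= ->.
Qed.

(** A prime dividing all three new integers divides m and n, hence k^3, hence k, against the given
    relation. *)
Lemma bezout3_minors (m k n : int) :
  (exists x y z, x * m + y * k + z * n = 1) ->
  exists x y z, x * m ^+ 3 + y * (k ^+ 3 + k * m * n) + z * n ^+ 3 = 1.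
Proof.
move=> [x [y [z e]]]; apply/bezout3P; set d := gcdz _ _.
have [//|nd] : d = 1 \/ `|d|%N != 1%N.
  by rewrite /d /gcdz; case: eqP => [/= ->|]; [left | right].
have [p p_pr pd] : exists2 p, prime p & (p %| `|d|)%N.
  (* A gcd equal to 0 is divisible by every prime. *)
  case: (posnP `|d|%N) => [->|]; first by exists 2%N.
  move=> d_gt0; exists (pdiv `|d|); rewrite ?pdiv_dvd // pdiv_prime //.
  by case: (`|d|%N) d_gt0 nd => [|[]].
have {}pd : (p%:Z %| d)%Z by [].
have prX (a : int) i : (p%:Z %| a ^+ i)%Z -> (p%:Z %| a)%Z.
  by rewrite !dvdzE /= abszX Euclid_dvdX // => /andP[].
move: pd; rewrite !dvdz_gcd => /andP[/andP[/prX pm pk] /prX pn].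
have {}pk : (p%:Z %| k)%Z.
  by apply: (@prX _ 3); move: pk; rewrite rpredDr // dvdz_mull.
have : (p%:Z %| x * m + y * k + z * n)%Z by rewrite !rpredD ?dvdz_mull.
by rewrite e dvdzE /= dvdn1 => /eqP p1; rewrite p1 in p_pr.
Qed.

Lemma bezout3_cofactor (a b c : int) : exists D a' b' c' : int,
  [/\ a = D * a', b = D * b', c = D * c'
    & D != 0 -> exists x y z, x * a' + y * b' + z * c' = 1].
Proof.
have [u [v e]] := Bezoutz (gcdz a b) c; have [x [y e']] := Bezoutz a b.
set D := gcdz (gcdz a b) c in e *.
have Da : (D %| a)%Z := dvdz_trans (dvdz_gcdl _ _) (dvdz_gcdl _ _).
have Db : (D %| b)%Z := dvdz_trans (dvdz_gcdl _ _) (dvdz_gcdr _ _).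
have Dc : (D %| c)%Z := dvdz_gcdr _ _.
case/dvdzP: Da => a' ea; case/dvdzP: Db => b' eb; case/dvdzP: Dc => c' ec.
exists D, a', b', c'; split; rewrite 1?mulrC // => D0.
exists (u * x), (u * y), v; apply: (mulfI D0).
by rewrite mulr1 -[RHS]e -e' ea eb ec; ring.
Qed.

Lemma mpoly_scaleI (c : int) (p q : {mpoly int[2]}) :
  c != 0 -> c *: p = c *: q -> p = q.
Proof.
move=> c0 e; apply/mpolyP => m; apply: (mulfI c0).
by rewrite -!mcoeffZ e.
Qed.

(** * Uniqueness and integrality of h for a primitive pair *)

Section IntegralForms.
Implicit Types (J F f g h p q : {mpoly int[2]}) (T : 'M[int]_2).

Lemma bezout3_minor f g : f \is 2.-homog -> g \is 2.-homog ->
  (exists x y z, x * pl2 f g + y * pl1 f g + z * pl0 f g = 1) ->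
  exists x y z, x * minor f g 0 1 2 + y * minor f g 0 2 4 + z * minor f g 2 3 4 = 1.
Proof.
move=> hf hg /bezout3_minors[x [y [z b]]]; exists x, y, z; rewrite -[RHS]b.
by have [m012 m024 m234] := minor_pl hf hg; rewrite m012 m024 m234.
Qed.

(** Cramer's rule recovers every minor times h from h(f, g), and the minors have an integral
    combination equal to 1. *)
Lemma bsubst_inj f g h h' :
  f \is 2.-homog -> g \is 2.-homog -> h \is 2.-homog -> h' \is 2.-homog ->
  (exists x y z, x * pl2 f g + y * pl1 f g + z * pl0 f g = 1) ->
  bsubst h f g = bsubst h' f g -> h = h'.
Proof.
move=> hf hg hh hh' /(bezout3_minor hf hg)[x [y [z]]] b e.
have E i j k : minor f g i j k *: h = minor f g i j k *: h'.
  have := cramer_bsubst f g i j k hh.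
  by rewrite e (cramer_bsubst f g i j k hh') => ->.
move: (E 0 1 2)%N (E 0 2 4)%N (E 2 3 4)%N b; move: (minor _ _) => m.
move: (m 0 1 2)%N (m 0 2 4)%N (m 2 3 4)%N => u v w eu ev ew b.
by rewrite -[h]scale1r -[h']scale1r -b !scalerDl -!scalerA eu ev ew.
Qed.

(** By Cramer's rule every minor times H is m times an integral form. The Bezout relation between
    the minors turns this into divisibility of H itself by m. *)
Lemma integral_bsubst F f g H (m : int) :
  f \is 2.-homog -> g \is 2.-homog -> H \is 2.-homog -> m != 0 ->
  (exists x y z, x * pl2 f g + y * pl1 f g + z * pl0 f g = 1) ->
  m *: F = bsubst H f g ->
  exists2 h, h \is 2.-homog & F = bsubst h f g.
Proof.
move=> hf hg hH m0 /(bezout3_minor hf hg)[x [y [z]]] b e.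
have hC i j k : cramer F f g i j k \is 2.-homog by exact: quad_homog.
have E i j k : minor f g i j k *: H = m *: cramer F f g i j k.
  by have := cramer_bsubst f g i j k hH; rewrite -e cramerZ => ->.
move: (E 0 1 2)%N (E 0 2 4)%N (E 2 3 4)%N (hC 0 1 2)%N (hC 0 2 4)%N (hC 2 3 4)%N b.
move: (minor _ _) (cramer _ _ _) => u C.
move: (u 0 1 2)%N (u 0 2 4)%N (u 2 3 4)%N (C 0 1 2)%N (C 0 2 4)%N (C 2 3 4)%N.
move=> u1 u2 u3 C1 C2 C3 e1 e2 e3 h1 h2 h3 b.
exists (x *: C1 + y *: C2 + z *: C3); first by rewrite !dhomogD ?dhomogZ.
apply: (mpoly_scaleI m0); rewrite e -bsubstZ; congr (bsubst _ f g).
rewrite -[LHS]scale1r -b !scalerDl -!scalerA e1 e2 e3.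
by rewrite !scalerDr !scalerA ![m * _]mulrC.
Qed.

(** * Forms orthogonal to J and the substitution by [M_of J] *)

Definition orth J q : int :=
  2 * bcoef J 2 0 * bcoef q 0 2 - bcoef J 1 1 * bcoef q 1 1
  + 2 * bcoef J 0 2 * bcoef q 2 0.

Lemma M_ofE J : [/\ M_of J 0 0 = bcoef J 1 1, M_of J 0 1 = 2 * bcoef J 0 2,
  M_of J 1 0 = - 2 * bcoef J 2 0 & M_of J 1 1 = - bcoef J 1 1].
Proof. by split; rewrite mxE. Qed.

Lemma det_M_of J : \det (M_of J) = - disc2 J.
Proof.
rewrite det_mx2; have [-> -> -> ->] := M_ofE J; rewrite /disc2.
by move: (bcoef J 2 0) (bcoef J 1 1) (bcoef J 0 2) => *; ring.
Qed.

(** Up to sign, [orth] is the polarization of [disc2]. For every quadratic q, substituting [M_of J]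
    gives disc(J) q + 2 orth(J, q) J, which is disc(J) times the reflection that negates J; the
    proof checks this coefficient by coefficient. *)
Lemma linsubst_orth J q : q \is 2.-homog -> orth J q = 0 ->
  linsubst (M_of J) q = disc2 J *: q.
Proof.
rewrite /orth /disc2 => /quadE eq e; rewrite [in LHS]eq [in RHS]eq linsubst_quad.
have [-> -> -> ->] := M_ofE J; move: e {eq}.
move: (bcoef J 2 0) (bcoef J 1 1) (bcoef J 0 2) => a b c.
move: (bcoef q 2 0) (bcoef q 1 1) (bcoef q 0 2) => x y z e.
have E (u v w : int) : u - v = w * (2 * a * z - b * y + 2 * c * x) -> u = v.
  by rewrite e mulr0 => /eqP; rewrite subr_eq0 => /eqP.
rewrite /quad !scalerDr !scalerA; congr (_ *: _ + _ *: _ + _ *: _).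
- by apply: (@E _ _ (2 * a)); ring.
- by apply: (@E _ _ (2 * b)); ring.
by apply: (@E _ _ (2 * c)); ring.
Qed.

Lemma toQ_inj : injective toQ.
Proof.
move=> p q e; apply/mpolyP => m; apply: (@intr_inj rat).
by rewrite -!mcoeff_map_mpoly -![map_mpoly _ _]/(toQ _) e.
Qed.

Lemma toQZ c p : toQ (c *: p) = c%:~R *: toQ p.
Proof. exact: map_mpolyZ. Qed.

Lemma toQ_linsubst T F : toQ (linsubst T F) = linsubst (map_mx intr T) (toQ F).
Proof.
rewrite /toQ /linsubst /bsubst map_mpoly_comp; last exact: intr_inj.
congr (_ \mPo _); apply/val_inj => /=.
by rewrite !mxE !raddfD /= !map_mpolyZ !map_mpolyX.
Qed.

(** The determinant of [M_of J] is [- disc2 J] and enters squared, so the sign drops out and the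
    rational condition becomes one over the integers. *)
Lemma in_VJP J F : disc2 J != 0 ->
  in_VJ J F <-> F \is 4.-homog /\ linsubst (M_of J) F = disc2 J ^+ 2 *: F.
Proof.
move=> J0; rewrite /in_VJ /twist4 det_map_mx det_M_of -toQ_linsubst.
have J0' : (disc2 J)%:~R ^+ 2 != 0 :> rat by rewrite expf_neq0 ?intr_eq0.
rewrite -exprVn rmorphN /= invrN sqrrN exprVn.
split=> -[hF e]; split=> //.
  by apply: toQ_inj; rewrite toQZ rmorphXn -e scalerA mulfV ?scale1r.
by rewrite e toQZ rmorphXn scalerA mulVf ?scale1r.
Qed.

Lemma jac_pl f g : [/\ bcoef (jac f g) 2 0 = pl2 f g,
  bcoef (jac f g) 1 1 = 2 * pl1 f g & bcoef (jac f g) 0 2 = pl0 f g].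
Proof. exact: jac_coefs. Qed.

Lemma disc2_jac f g : disc2 (jac f g) = 4 * (pl1 f g ^+ 2 - pl2 f g * pl0 f g).
Proof.
rewrite /disc2; have [-> -> ->] := jac_pl f g.
by move: (pl2 f g) (pl1 f g) (pl0 f g) => *; ring.
Qed.

Lemma proportional_jacP J f g : quad_form J ->
  proportional (jac f g) J <->
  exists n d : int, [/\ n != 0, d != 0, d * pl2 f g = n * bcoef J 2 0,
    d * (2 * pl1 f g) = n * bcoef J 1 1 & d * pl0 f g = n * bcoef J 0 2].
Proof.
move=> hJ; have [j2 j1 j0] := jac_pl f g.
have hj : jac f g \is 2.-homog by exact: quad_homog.
split=> [[c c0 e]|[n [d [n0 d0 e2 e1 e0]]]].
  have E i j : denq c * bcoef (jac f g) i j = numq c * bcoef J i j.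
    apply: (@intr_inj rat); rewrite !rmorphM /= numqE.
    rewrite /bcoef -!mcoeff_map_mpoly -![map_mpoly _ _]/(toQ _) e mcoeffZ.
    by rewrite mulrCA mulrA.
  exists (numq c), (denq c); rewrite numq_eq0 c0 denq_neq0.
  by rewrite -j2 -j1 -j0 !E.
exists (n%:~R / d%:~R); first by rewrite mulf_neq0 ?invr_eq0 ?intr_eq0.
have : d *: jac f g = n *: J.
  by apply: quad_eq; rewrite ?dhomogZ // !bcoefZ ?j2 ?j1 ?j0.
move=> /(congr1 toQ); rewrite !toQZ mulrC -scalerA => <-.
by rewrite scalerA mulVf ?scale1r ?intr_eq0.
Qed.

Lemma orth_pl J f g q : quad_form J -> proportional (jac f g) J ->
  (orth J q = 0 <->
   pl2 f g * bcoef q 0 2 - pl1 f g * bcoef q 1 1 + pl0 f g * bcoef q 2 0 = 0).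
Proof.
move=> hJ /(proportional_jacP _ _ hJ)[n [d [n0 d0]]]; rewrite /orth.
move: (bcoef J 2 0) (bcoef J 1 1) (bcoef J 0 2) (pl2 f g) (pl1 f g) (pl0 f g).
move: (bcoef q 2 0) (bcoef q 1 1) (bcoef q 0 2) => q2 q1 q0 a b c u v w e2 e1 e0.
have E : 2 * d * (u * q0 - v * q1 + w * q2)
    = n * (2 * a * q0 - b * q1 + 2 * c * q2).
  transitivity (2 * (d * u) * q0 - d * (2 * v) * q1 + 2 * (d * w) * q2).
    by ring.
  by rewrite e2 e1 e0; ring.
have d20 : 2 * d != 0 by rewrite mulf_neq0.
split=> e; first by apply: (mulfI d20); rewrite E e !mulr0.
by apply: (mulfI n0); rewrite -E e !mulr0.
Qed.

(** For q = f or q = g the determinant in [orth_pl] has a repeated row. *)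
Lemma orth_proportional J f g : quad_form J -> proportional (jac f g) J ->
  orth J f = 0 /\ orth J g = 0.
Proof.
move=> hJ hp; split; apply/(orth_pl _ hJ hp); rewrite /pl2 /pl1 /pl0;
  move: (bcoef f 2 0) (bcoef f 1 1) (bcoef f 0 2);
  move: (bcoef g 2 0) (bcoef g 1 1) (bcoef g 0 2) => *; ring.
Qed.

Lemma disc2_jac_neq0 J f g : quad_form J -> disc2 J != 0 ->
  proportional (jac f g) J -> disc2 (jac f g) != 0.
Proof.
move=> hJ J0 /(proportional_jacP _ _ hJ)[n [d [n0 d0]]].
rewrite disc2_jac; move: J0; rewrite /disc2.
move: (bcoef J 2 0) (bcoef J 1 1) (bcoef J 0 2) (pl2 f g) (pl1 f g) (pl0 f g).
move=> a b c u v w J0 e2 e1 e0.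
have : n ^+ 2 * (b ^+ 2 - 4 * a * c) != 0 by rewrite mulf_neq0 ?expf_neq0.
apply: contra => /eqP e; apply/eqP.
transitivity ((n * b) ^+ 2 - 4 * (n * a) * (n * c)); first by ring.
rewrite -e2 -e1 -e0; transitivity (d ^+ 2 * (4 * (v ^+ 2 - u * w))).
  by ring.
by rewrite e mulr0.
Qed.

Lemma primitive_pairP f g : primitive_pair f g <-> disc2 (jac f g) != 0 /\
  exists x y z, x * pl2 f g + y * pl1 f g + z * pl0 f g = 1.
Proof.
rewrite /primitive_pair; have [-> -> ->] := jac_pl f g.
by rewrite mulKz // bezout3P.
Qed.

Lemma linsubst_bsubst J h f g :
  h \is 2.-homog -> f \is 2.-homog -> g \is 2.-homog ->
  orth J f = 0 -> orth J g = 0 ->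
  linsubst (M_of J) (bsubst h f g) = disc2 J ^+ 2 *: bsubst h f g.
Proof.
move=> hh hf hg of_ og; rewrite {1}/linsubst bsubst_bsubst //.
rewrite -[X in bsubst h X]/(linsubst _ _) -[X in bsubst h _ X]/(linsubst _ _).
by rewrite !linsubst_orth // bsubst_scale.
Qed.

(** Dividing the equation of the orthogonal lattice by its content D gives u q2 + v q1 + w q0 = 0
    with u, v, w coprime. With d = gcd(u, v), f generates the solutions with q0 = 0, and g is a
    solution with q0 = - d. The minors of (f, g) are then u, v, w up to sign and order. *)
Lemma orth_basis J : quad_form J -> disc2 J != 0 ->
  exists f g, [/\ f \is 2.-homog, g \is 2.-homog, proportional (jac f g) J
    & exists x y z, x * pl2 f g + y * pl1 f g + z * pl0 f g = 1].
Proof.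
move=> hJ; rewrite /disc2 => J0.
(* The nonzero discriminant rules out u = v = 0, so that both D and d are nonzero. *)
have nz : 2 * bcoef J 0 2 = 0 -> - bcoef J 1 1 = 0 -> False.
  move=> /eqP + /eqP; rewrite mulf_eq0 oppr_eq0 /= => /eqP c0 /eqP b0.
  by rewrite c0 b0 mulr0 subr0 expr0n eqxx in J0.
have [D [u [v [w [eu ev ew]]]]] :=
  bezout3_cofactor (2 * bcoef J 0 2) (- bcoef J 1 1) (2 * bcoef J 2 0).
have uv0 : ~ (u = 0 /\ v = 0).
  by move=> [u0 v0]; apply: nz; rewrite ?eu ?ev ?u0 ?v0 mulr0.
have D0 : D != 0.
  by apply/eqP => D0; apply: nz; rewrite ?eu ?ev D0 mul0r.
move=> /(_ D0) [x [y [z b]]].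
have [r [s ed]] := Bezoutz u v; set d := gcdz u v in ed.
have /dvdzP[u' eu'] : (d %| u)%Z := dvdz_gcdl _ _.
have /dvdzP[v' ev'] : (d %| v)%Z := dvdz_gcdr _ _.
have d0 : d != 0.
  by apply/eqP => d0; apply: uv0; rewrite eu' ev' d0 !mulr0.
have e1 : r * u' + s * v' = 1.
  by apply: (mulfI d0); rewrite mulr1 -[RHS]ed eu' ev'; ring.
pose f := quad (- v') u' 0; pose g := quad (w * r) (w * s) (- d).
have [f2 f1 f0] := quad_coefs (- v') u' 0.
have [g2 g1 g0] := quad_coefs (w * r) (w * s) (- d).
have p2 : pl2 f g = - w.
  rewrite /pl2 f2 f1 g2 g1 -[in RHS](mulr1 w) -e1; ring.
have p1 : pl1 f g = v by rewrite /pl1 f2 f0 g2 g0 ev'; ring.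
have p0 : pl0 f g = - u by rewrite /pl0 f1 f0 g1 g0 eu'; ring.
exists f, g; split; rewrite ?quad_homog //.
  apply/proportional_jacP => //; exists (- 2), D; split => //.
  - by rewrite p2 mulrN -ew mulNr.
  - by rewrite p1 mulrCA -ev mulrN mulNr.
  by rewrite p0 mulrN -eu mulNr.
exists (- z), y, (- x); rewrite p2 p1 p0 -[RHS]b; ring.
Qed.

(** Cramer's rule in three rows gives a quartic [G] with the same eigenvalue as F and three zero
    coefficients. The rows are chosen by a nonzero coefficient of J: their minor is then nonzero,
    and the eigenvalue equation annihilates the other two coefficients of [G]. *)
Lemma fixed_rational_combination J F f g :
  quad_form J -> disc2 J != 0 -> f \is 2.-homog -> g \is 2.-homog ->
  proportional (jac f g) J -> F \is 4.-homog ->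
  linsubst (M_of J) F = disc2 J ^+ 2 *: F ->
  exists m : int, m != 0 /\ exists2 H, H \is 2.-homog & m *: F = bsubst H f g.
Proof.
move=> hJ J0 hf hg hp hF hMF.
have [n [d [n0 d0 e2 e1 e0]]] := (proportional_jacP f g hJ).1 hp.
have [of_ og] := orth_proportional hJ hp.
pose m i j k := minor f g i j k.
pose H i j k := cramer F f g i j k.
pose G i j k := m i j k *: F - bsubst (H i j k) f g.
have hH i j k : H i j k \is 2.-homog by exact: quad_homog.
have hG i j k : G i j k \is 4.-homog.
  by rewrite rpredB ?dhomogZ ?bsubst_homog.
have MG i j k : linsubst (M_of J) (G i j k) = disc2 J ^+ 2 *: G i j k.
  rewrite /G scalerBr -linsubst_bsubst // scalerA mulrC -scalerA -hMF.
  by rewrite /linsubst /bsubst raddfB /= comp_mpolyZ.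
have G0 i j k l : l \in [:: i; j; k] -> qco (G i j k) l = 0.
  by move=> hl; rewrite /G -scaleN1r qcoD !qcoZ /H qco_cramer // mulN1r subrr.
suff [i [j [k [mi gi]]]] : exists i j k, m i j k != 0 /\ G i j k = 0.
  by exists (m i j k); split=> //; exists (H i j k) => //; apply/subr0_eq.
have detM : M_of J 0 0 * M_of J 1 1 - M_of J 0 1 * M_of J 1 0 != 0.
  by rewrite -det_mx2 det_M_of oppr_eq0.
have [M00 M01 M10 M11] := M_ofE J.
have [m012 m024 m234] := minor_pl hf hg.
have [al0|al0] := eqVneq (bcoef J 2 0) 0; last first.
  exists 0%N, 1%N, 2%N; split.
    rewrite /m m012 expf_neq0 //; apply/eqP => p0; move: e2 => /eqP.
    by rewrite p0 mulr0 eq_sym mulf_eq0 (negbTE n0) (negbTE al0).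
  have := quarticE (hG 0 1 2)%N;
    rewrite (G0 0 1 2 0)%N // (G0 0 1 2 1)%N // (G0 0 1 2 2)%N // => GE.
  have := MG 0%N 1%N 2%N; rewrite GE => /eigenquartic_eq0_y[] //.
    by rewrite M10 mulf_neq0.
  by move=> q1 q2; rewrite q1 q2 quartic0.
have [ga0|ga0] := eqVneq (bcoef J 0 2) 0; last first.
  exists 2%N, 3%N, 4%N; split.
    rewrite /m m234 expf_neq0 //; apply/eqP => p0; move: e0 => /eqP.
    by rewrite p0 mulr0 eq_sym mulf_eq0 (negbTE n0) (negbTE ga0).
  have := quarticE (hG 2 3 4)%N;
    rewrite (G0 2 3 4 2)%N // (G0 2 3 4 3)%N // (G0 2 3 4 4)%N // => GE.
  have := MG 2%N 3%N 4%N; rewrite GE => /eigenquartic_eq0_x[] //.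
    by rewrite M01 mulf_neq0.
  by move=> q1 q2; rewrite q1 q2 quartic0.
(* Now J is be x y and [M_of J] is diagonal with entries be and - be. It multiplies the coefficients
   of x^3 y and x y^3 by - be^4, while the eigenvalue is be^4, so both vanish. *)
have be0 : bcoef J 1 1 != 0.
  by apply: contra J0 => /eqP be0; rewrite /disc2 al0 ga0 be0 mulr0 subr0 expr0n.
exists 0%N, 2%N, 4%N; split.
  have p2 : pl2 f g = 0 by apply: (mulfI d0); rewrite e2 al0 !mulr0.
  have -> : m 0%N 2%N 4%N = pl1 f g ^+ 3.
    by rewrite /m m024 p2; move: (pl1 f g) (pl0 f g) => *; ring.
  rewrite expf_neq0 //; apply/eqP => p0; move: e1 => /eqP.
  by rewrite p0 !mulr0 eq_sym mulf_eq0 (negbTE n0) (negbTE be0).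
have GE := quarticE (hG 0 2 4)%N.
rewrite (G0 0 2 4 0)%N // (G0 0 2 4 2)%N // (G0 0 2 4 4)%N // in GE.
have hD : disc2 J = bcoef J 1 1 ^+ 2.
  by rewrite /disc2 al0; move: (bcoef J 1 1) (bcoef J 0 2) => *; ring.
have := MG 0%N 2%N 4%N; rewrite GE linsubst_quartic => E.
have := congr1 (fun q => qco q 1) E; have := congr1 (fun q => qco q 3) E.
rewrite !qcoZ !qco_quartic M00 M01 M10 M11 al0 ga0 hD => {E} E3 E1.
suff [b0 c0] : qco (G 0 2 4)%N 1 = 0 /\ qco (G 0 2 4)%N 3 = 0.
  by rewrite b0 c0 quartic0.
move: (bcoef J 1 1) (qco _ 1) (qco _ 3) be0 E1 E3 => t b c t0 E1 E3.
have t4 : 2 * t ^+ 4 != 0 by rewrite mulf_neq0 ?expf_neq0.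
split; apply: (mulfI t4); rewrite mulr0.
  by rewrite -(subrr ((t ^+ 2) ^+ 2 * b)) -[in X in _ - X]E1; ring.
by rewrite -(subrr ((t ^+ 2) ^+ 2 * c)) -[in X in _ - X]E3; ring.
Qed.

End IntegralForms.

Theorem theorem3p1 (J F : {mpoly int[2]})
    (J_quad : quad_form J) (J_prim : primitive_form J) (J_disc : disc2 J != 0)
    (F_quartic : quartic_form F) (F_disc : disc4 F != 0) :
  [/\ (in_VJ J F <->
         exists h f g : {mpoly int[2]}, representation J F h f g),
      (forall h f g : {mpoly int[2]}, representation J F h f g ->
         ((disc2 h * (disc2 (jac f g) %/ 4)%Z) ^+ 2 %| disc4 F)%Z),
      (in_VJ J F ->
         exists h f g : {mpoly int[2]},
           representation J F h f g /\ primitive_pair f g)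
    & (forall h f g h' f' g' : {mpoly int[2]},
         representation J F h f g -> primitive_pair f g ->
         representation J F h' f' g' -> primitive_pair f' g' ->
         GL2Z_equiv h h'
         /\ (jac f g = jac f' g' -> GL2Z_twist_equiv h h'))].
Proof.
have exists_primitive : in_VJ J F -> exists h f g : {mpoly int[2]},
    representation J F h f g /\ primitive_pair f g.
  move=> /(in_VJP _ J_disc)[hF MF].
  have [f [g [hf hg hp bez]]] := orth_basis J_quad J_disc.
  have [m [m0 [H hH e]]] :=
    fixed_rational_combination J_quad J_disc hf hg hp hF MF.
  have [h hh eh] := integral_bsubst hf hg hH m0 bez e.
  exists h, f, g; split=> //; apply/primitive_pairP; split=> //.
  exact: disc2_jac_neq0 hp.
split=> //.
- split=> [/exists_primitive[h [f [g [hr _]]]]|]; first by exists h, f, g.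
  move=> [h [f [g [hh hf hg -> hp]]]]; apply/in_VJP => //.
  have [of_ og] := orth_proportional J_quad hp.
  by split; [exact: bsubst_homog | exact: linsubst_bsubst].
- move=> h f g [hh hf hg -> _].
  have [c ->] := disc4_bsubst hh hf hg.
  by rewrite disc2_jac mulKz // dvdz_mulr.
move=> h f g h' f' g' [hh hf hg eF hp] /primitive_pairP[_ bez].
move=> [hh' hf' hg' eF' hp'] /primitive_pairP[_ [x' [y' [z' bez']]]].
have [x [y [z b]]] := bez.
have [of_ og] := orth_proportional J_quad hp'.
have ef := span_of_orth hf hg hf' b ((orth_pl _ J_quad hp).1 of_).
have eg := span_of_orth hf hg hg' b ((orth_pl _ J_quad hp).1 og).
move: ef eg; set s := (X in X *: _ + _); set t := (X in _ + X *: _) => ef.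
set u := (X in X *: _ + _); set v := (X in _ + X *: _) => eg.
(* From here on only f' = s f + t g and g' = u f + v g are kept. *)
move: s t u v ef eg => s t u v ef eg.
have [] := pl_span f g s t u v; rewrite -ef -eg => E2 E1 E0.
pose T : 'M[int]_2 := \matrix_(i, j) if i == 0 then (if j == 0 then s else t)
                                     else (if j == 0 then u else v).
have T00 : T 0 0 = s by rewrite mxE.
have T01 : T 0 1 = t by rewrite mxE.
have T10 : T 1 0 = u by rewrite mxE.
have T11 : T 1 1 = v by rewrite mxE.
have detT : \det T = s * v - t * u by rewrite det_mx2 T00 T01 T10 T11.
(* The minors of (f', g') are \det T times those of (f, g), so a Bezout relation for (f', g')
   exhibits an inverse of \det T. *)
have unitT : T \in unitmx.
  rewrite unitmxE; apply/unitrPr; rewrite detT.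
  exists (x' * pl2 f g + y' * pl1 f g + z' * pl0 f g).
  rewrite -bez' E2 E1 E0.
  by move: (pl2 f g) (pl1 f g) (pl0 f g) => *; ring.
(* Both sides give F when evaluated at (f, g), and a primitive pair determines h. *)
have hT : h = linsubst T h'.
  apply: (bsubst_inj hf hg hh _ bez).
    exact: linsubst_homog2.
  by rewrite (bsubst_linsubst T f g hh') T00 T01 T10 T11 -ef -eg -eF.
split=> [|ej]; exists T => //.
suff -> : twist2 T h' = linsubst T h' by [].
(* Equal Jacobians mean equal minors, so the Bezout relation for (f, g) evaluates to both 1 and \det
   T. *)
have det1 : \det T = 1.
  have [j2 j1 j0] := jac_pl f g; have [j2' j1' j0'] := jac_pl f' g'.
  have q2 : pl2 f' g' = pl2 f g by rewrite -j2 -j2' ej.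
  have q0 : pl0 f' g' = pl0 f g by rewrite -j0 -j0' ej.
  have q1 : pl1 f' g' = pl1 f g.
    by apply: (@mulfI int 2 isT); rewrite -j1 -j1' ej.
  rewrite detT; have : x * pl2 f' g' + y * pl1 f' g' + z * pl0 f' g' = 1.
    by rewrite q2 q1 q0.
  rewrite E2 E1 E0 => <-.
  transitivity ((s * v - t * u) * (x * pl2 f g + y * pl1 f g + z * pl0 f g)).
    by rewrite b mulr1.
  by move: (pl2 f g) (pl1 f g) (pl0 f g); clear; move: s t u v => *; ring.
rewrite /twist2 det1 invr1; exact: scale1r.
Qed.
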